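(* Let $\Lambda,\mu,R>0$, $\rho=\Lambda/\mu$, and $C_1,C_2\ge0$ with $\max\{C_1,C_2\}>0$. In the observable infinite-server queue there exists a unique optimal (revenue-maximizing) threshold strategy, given by $$n_m=\max\left\{N\ge1:\ \frac{\sum_{i=1}^2C_i\bigl(\mathbb{E}(L_N)(N-1)^i-\mathbb{E}(L_{N-1})(N-2)^i\bigr)}{\mathbb{E}(L_N)-\mathbb{E}(L_{N-1})}\le R\right\},$$ such that $S^r_m(n)$ is strictly increasing in $n$ when $n\le n_m$ and strictly decreasing in $n$ when $n>n_m$. Moreover, $n_m$ is increasing (in the non-strict sense) in $\rho$, with $R,C_1,C_2$ fixed, and the optimal price for the system administrator is $\widetilde P_o=R-[C_1(n_m-1)+C_2(n_m-1)^2]$.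
   Context: Customers arrive to an infinite-server system in a Poisson process of rate $\Lambda>0$; sojourn times are i.i.d. with mean $1/\mu$; $\rho=\Lambda/\mu$. A customer joining when $m$ customers are present and paying price $P$ has utility $R-P-(C_1m+C_2m^2)$; a balking customer has utility $0$; customers see the number present and join if and only if the utility of joining is nonnegative. If all customers use threshold $n$ (join if and only if the number present is less than $n$), the system is an $M/G/n/n$ queue with expected queue length $$\mathbb{E}(L_n)=\frac{\rho\sum_{k=0}^{n-1}\rho^k/k!}{\sum_{k=0}^n\rho^k/k!},\qquad \mathbb{E}(L_0)=0,$$ and actual joining rate $\mu\mathbb{E}(L_n)$. The best (largest) price inducing threshold $n$ is $P_o=R-[C_1(n-1)+C_2(n-1)^2]$, and the expected revenue per time unit under threshold $n\in\{0,1,2,\dots\}$ is $$S^r_m(n)=\mu\,\mathbb{E}(L_n)\bigl[R-(C_1(n-1)+C_2(n-1)^2)\bigr].$$ A threshold $n\ge1$ is called optimal (for revenue) if $S^r_m(n)\ge S^r_m(n-1)$ and $S^r_m(n)>S^r_m(n+1)$. The optimal price is the price $P_o$ corresponding to the optimal threshold.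
   Formalization: If the ratio at N=n_m equals R, then S(n_m-1)=S(n_m) (e.g. Λ=μ=C_1=1, C_2=0, R=8/3, n_m=2), so strict increase for n≤n_m fails; it is claimed up to n_m when the ratio is not R, and otherwise up to n_m-1, with S(n_m-1)≤S(n_m), equality exactly when the ratio is R. *)

(* Defs.v *)
From mathcomp Require Import all_boot all_order all_algebra.
From mathcomp Require Import reals.

Set Implicit Arguments.
Unset Strict Implicit.
Unset Printing Implicit Defensive.

Import Order.TTheory GRing.Theory Num.Theory.

Local Open Scope ring_scope.

(* The argument ranges over K and not over nat because the revenue evaluates cost
   at n - 1, which is negative for n = 0. *)
Definition cost (K : realType) (C1 C2 x : K) : K := C1 * x + C2 * x ^+ 2.

(* Mean number present in the stationary M/G/n/n queue with offered load rho;
   for n = 0 the numerator is an empty sum, so the value is 0. *)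
Definition EL (K : realType) (rho : K) (n : nat) : K :=
  (rho * \sum_(0 <= k < n) rho ^+ k / (k`!)%:R)
  / \sum_(0 <= k < n.+1) rho ^+ k / (k`!)%:R.

Definition joins (K : realType) (R C1 C2 P : K) (m : nat) : bool :=
  0 <= R - P - cost C1 C2 m%:R.

Definition induces_threshold (K : realType) (R C1 C2 P : K) (n : nat) : Prop :=
  forall m : nat, joins R C1 C2 P m = (m < n)%N.

Definition best_price (K : realType) (R C1 C2 P : K) (n : nat) : Prop :=
  induces_threshold R C1 C2 P n /\
  forall Q : K, induces_threshold R C1 C2 Q n -> Q <= P.

Definition revenue (K : realType) (mu rho R C1 C2 : K) (n : nat) : K :=
  mu * EL rho n * (R - cost C1 C2 (n%:R - 1)).

Definition optimal_threshold (K : realType) (mu rho R C1 C2 : K) (n : nat)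
    : Prop :=
  [/\ (1 <= n)%N,
      revenue mu rho R C1 C2 n.-1 <= revenue mu rho R C1 C2 n
    & revenue mu rho R C1 C2 n.+1 < revenue mu rho R C1 C2 n].

Definition optimal_price (K : realType) (mu rho R C1 C2 P : K) : Prop :=
  exists n : nat,
    optimal_threshold mu rho R C1 C2 n /\ best_price R C1 C2 P n.

Definition threshold_ratio (K : realType) (rho C1 C2 : K) (N : nat) : K :=
  (C1 * (EL rho N * (N%:R - 1) - EL rho N.-1 * (N%:R - 2))
   + C2 * (EL rho N * (N%:R - 1) ^+ 2 - EL rho N.-1 * (N%:R - 2) ^+ 2))
  / (EL rho N - EL rho N.-1).

Definition is_max (A : nat -> Prop) (n : nat) : Prop :=
  A n /\ forall m : nat, A m -> (m <= n)%N.

(* Main.v *)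
Require Import Defs.
From mathcomp Require Import all_boot all_order all_algebra.
From mathcomp Require Import reals.
From mathcomp Require Import normedtype derive realfun.
From mathcomp Require Import boolp functions.
From mathcomp Require Import ring lra.

Import Order.TTheory GRing.Theory Num.Theory.
Import numFieldNormedType.Exports.
Local Open Scope ring_scope.

Set Implicit Arguments.
Unset Strict Implicit.

(** Raising the threshold from [n - 1] to [n] changes the revenue by
    [mu * (E n - E (n - 1)) * (R - f n)], where [E n] is the mean queue length
    and [f n] the quotient compared with [R] in the definition of the threshold
    [n_m].  Since [E] is strictly increasing, the sign of the change is that of
    [R - f n].  Every claim at a fixed load therefore follows once [f] is
    strictly increasing with [f 1 = 0] and unbounded, and the monotonicity of
    [n_m] in the load follows once [f n] is nonincreasing in the load.

    Write [c] for the waiting cost.  Then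
      [f (n + 1) = c n + gap n * (c n - c (n - 1))],
      [gap n = E n / (E (n + 1) - E n)],
    ([threshold_ratio_split]) and [c] is increasing and convex, so both
    monotonicities reduce to those of [gap]:
    - [gap] is nondecreasing in [n] as soon as [E] is concave in [n];
    - for [n > 0], [gap n] is nonincreasing in the load iff [E (n + 1) / E n] is
      nondecreasing, and from [E n ' = E n * (1 + E (n - 1) - E n) / rho] the logarithmic
      derivative of [E (n + 1) / E n] is [(2 E n - E (n + 1) - E (n - 1)) / rho],
      again nonnegative by concavity of [E] in [n].

    So the core is the concavity of [E] ([EL_concave]).  The lost rate
    [y n = rho - E n] (load times blocking probability) satisfies the Erlang
    recursion [y (n + 1) * (n + 1 + y n) = rho * y n].  Eliminating
    [y (n - 1)] and [y (n + 1)] turns convexity of [y] at [n] into nonnegativity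
    of a quadratic in [y n] ([curv]).  The recursion preserves the property that
    [y n] lies to the right of the larger root of that quadratic
    ([beyond_root_step]), and initially [y 0 = rho] is this root. *)

(** * The Erlang recursion stays beyond the root of a quadratic *)

(** With [y] the lost rate for [n - 1] servers and load [rho], and [x], [z] its
    neighbours in the recursion, [x + z - 2 * y] is a positive multiple of this
    quadratic; see [beyond_root_convex]. *)
Definition curv {F : realFieldType} (n rho y : F) : F :=
  2 * y ^+ 2 - (3 * (rho - n) + 1) * y + (rho - n) ^+ 2 - n.

(** The second condition puts [y] to the right of the vertex of the quadratic, so
    that nonnegativity means being beyond the larger root. *)
Definition beyond_root {F : realFieldType} (n rho y : F) : Prop :=
  0 <= curv n rho y /\ 3 * (rho - n) + 1 <= 4 * y.

(** The quadratic takes the value [- 4 * rho ^+ 3 / A ^+ 2 < 0] at [B / A], where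
    [A] and [B] are the two polynomials of the conclusion.  Hence [B / A] lies
    strictly between the roots, and [y] lies to its right. *)
Lemma beyond_root_bound (F : realFieldType) (n rho y : F) :
  0 < n -> 0 < rho -> beyond_root n rho y ->
  let s := rho - n in
  s ^+ 3 + s ^+ 2 + 3 * s * n - n <= (s ^+ 2 + 2 * n + 1) * y.
Proof.
rewrite /beyond_root /curv => n0; have -> : rho = (rho - n) + n by ring.
move: (rho - n) => s; rewrite !addrK => r0 [c0 c1] /=.
set A := s ^+ 2 + 2 * n + 1; set B := s ^+ 3 + _ + _ - _.
have A0 : 0 < A by rewrite /A; nra.
rewrite leNgt; apply/negP => lt_AB.
have id : A ^+ 2 * (2 * y ^+ 2 - (3 * s + 1) * y + s ^+ 2 - n)
  = - 4 * (s + n) ^+ 3 - (B - A * y) * (2 * A * y + 2 * B - (3 * s + 1) * A).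
  by rewrite /A /B; ring.
have f0 : 0 <= 2 * A * y + 2 * B - (3 * s + 1) * A by nra.
have := mulr_ge0 (sqr_ge0 A) c0; rewrite id leNgt => /negP; apply.
have r3 : 0 < (s + n) ^+ 3 by rewrite exprn_gt0 //; lra.
have p0 : 0 <= (B - A * y) * (2 * A * y + 2 * B - (3 * s + 1) * A).
  by rewrite mulr_ge0 // subr_ge0 ltW.
lra.
Qed.

(** Substituting [z = rho * y / (n + y)] into the next quadratic and reducing
    modulo the current one leaves, up to positive factors, a nonnegative
    multiple of the current value plus the linear form [A * y - B] that
    [beyond_root_bound] shows to be nonnegative.  The position relative to the
    vertex propagates by the same bound. *)
Lemma beyond_root_step (F : realFieldType) (n rho y z : F) :
  0 < n -> 0 < rho -> 0 < y -> z * (n + y) = rho * y ->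
  beyond_root n rho y -> beyond_root (n + 1) rho z.
Proof.
move=> n0 r0 y0 zE bry; have := beyond_root_bound n0 r0 bry.
case: bry; rewrite /beyond_root /curv.
have -> : rho - (n + 1) = (rho - n) - 1 by ring.
move: zE r0; have -> : rho = (rho - n) + n by ring.
move: (rho - n) => s; rewrite !addrK => zE r0 c0 c1 /=; rewrite -subr_ge0.
set u := _ - _ => u0.
have ny0 : 0 < n + y by lra.
have -> : z = (s + n) * y / (n + y) by rewrite -zE mulfK ?gt_eqF.
split.
  have -> : 2 * ((s + n) * y / (n + y)) ^+ 2
      - (3 * (s - 1) + 1) * ((s + n) * y / (n + y)) + (s - 1) ^+ 2 - (n + 1)
    = n / 2 * ((s + n + n + 1) * (2 * y ^+ 2 - (3 * s + 1) * y + s ^+ 2 - n) + u)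
      / (n + y) ^+ 2.
    by rewrite /u; field; rewrite gt_eqF.
  apply: divr_ge0; last exact: sqr_ge0.
  apply: mulr_ge0; first lra.
  by rewrite addr_ge0 // mulr_ge0 //; lra.
rewrite mulrA ler_pdivlMr //.
have [s0|s0] := lerP s 0; first by nra.
(* For s > 0 the linear form in y is reduced with A * y >= B; the remainder is a
   polynomial in s and n with nonnegative coefficients. *)
rewrite -subr_ge0 -(pmulr_rge0 _ (_ : 0 < s ^+ 2 + 2 * n + 1)); last by nra.
have -> : (s ^+ 2 + 2 * n + 1)
    * (4 * ((s + n) * y) - (3 * (s - 1) + 1) * (n + y))
  = (s + 4 * n + 2) * u + (s ^+ 4 + n * s ^+ 3 + 3 * s ^+ 3 + 9 * n * s ^+ 2
     + 2 * s ^+ 2 + 6 * s * n ^+ 2 + 2 * s * n) by rewrite /u; ring.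
apply: addr_ge0; first by rewrite mulr_ge0 //; lra.
by rewrite !(addr_ge0, mulr_ge0, exprn_ge0) // ltW.
Qed.

Lemma beyond_root_convex (F : realFieldType) (n rho x y z : F) :
  0 < n -> 0 < y < rho -> y * (n - 1 + x) = rho * x -> z * (n + y) = rho * y ->
  beyond_root n rho y -> 2 * y <= x + z.
Proof.
move=> n0 /andP[y0 yr] xE zE [c0 _].
have ny0 : 0 < n + y by lra.
have ry0 : 0 < rho - y by lra.
have -> : z = rho * y / (n + y) by rewrite -zE mulfK ?gt_eqF.
have xE' : x * (rho - y) = (n - 1) * y.
  by rewrite mulrBr [x * rho]mulrC -xE; ring.
have -> : x = (n - 1) * y / (rho - y) by rewrite -xE' mulfK ?gt_eqF.
rewrite -subr_ge0.
have -> : (n - 1) * y / (rho - y) + rho * y / (n + y) - 2 * y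
  = y * curv n rho y / ((rho - y) * (n + y)).
  by rewrite /curv; field; rewrite !gt_eqF.
by rewrite divr_ge0 // mulr_ge0 // ltW.
Qed.

(** * The mean queue length *)

Definition expsum {K : realType} (rho : K) (n : nat) : K :=
  \sum_(0 <= k < n) rho ^+ k / (k`!)%:R.

Section Erlang.
Context {K : realType}.
Implicit Types (rho x : K) (n : nat).

Lemma expsum0 rho : expsum rho 0 = 0.
Proof. by rewrite /expsum big_nil. Qed.

Lemma expsumS rho n :
  expsum rho n.+1 = expsum rho n + rho ^+ n / (n`!)%:R.
Proof. by rewrite /expsum big_nat_recr. Qed.

Lemma expsum_gt0 rho n : 0 < rho -> 0 < expsum rho n.+1.
Proof.
move=> r0; elim: n => [|n IH]; last first.
  by rewrite expsumS addr_gt0 // divr_gt0 ?exprn_gt0 // ltr0n fact_gt0.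
by rewrite /expsum big_nat1 expr0 fact0 divr1.
Qed.

Lemma EL_expsum rho n : EL rho n = rho * expsum rho n / expsum rho n.+1.
Proof. by []. Qed.

Lemma EL0 rho : EL rho 0 = 0.
Proof. by rewrite /EL big_nil mulr0 mul0r. Qed.

Lemma EL_ge0 rho n : 0 < rho -> 0 <= EL rho n.
Proof.
case: n => [|n] r0; first by rewrite EL0.
by rewrite EL_expsum divr_ge0 ?mulr_ge0 // ltW // expsum_gt0.
Qed.

Lemma EL_lt_load rho n : 0 < rho -> EL rho n < rho.
Proof.
move=> r0; rewrite EL_expsum ltr_pdivrMr ?expsum_gt0 // ltr_pM2l //.
by rewrite expsumS ltrDl divr_gt0 ?exprn_gt0 // ltr0n fact_gt0.
Qed.

Lemma EL_rec rho n : 0 < rho ->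
  EL rho n.+1 * (n.+1%:R + (rho - EL rho n)) = rho * n.+1%:R.
Proof.
move=> r0; rewrite !EL_expsum.
have D1 := expsum_gt0 n r0; have D2 := expsum_gt0 n.+1 r0.
have Dn : expsum rho n = expsum rho n.+1 - rho ^+ n / (n`!)%:R.
  by rewrite expsumS addrK.
have f0 : (n`!%:R : K) != 0 by rewrite pnatr_eq0 -lt0n fact_gt0.
have n0 : (n.+1%:R : K) != 0 by rewrite pnatr_eq0.
rewrite Dn; move: D2; rewrite expsumS factS natrM exprS => D2.
have p0 : 0 < (n.+1%:R : K) * n`!%:R by rewrite mulr_gt0 // ltr0n fact_gt0.
field; rewrite (gt_eqF D1) f0 addrC natr1 n0 /=; apply: lt0r_neq0.
by have := mulr_gt0 D2 p0; rewrite mulrDl divfK ?gt_eqF.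
Qed.

(** This is the classical Erlang recursion
    [B (n + 1) = rho * B n / (n + 1 + rho * B n)] for the blocking probability
    [B n], multiplied by [rho]. *)
Lemma lost_rec rho n : 0 < rho ->
  (rho - EL rho n.+1) * (n.+1%:R + (rho - EL rho n)) = rho * (rho - EL rho n).
Proof. by move=> r0; rewrite mulrBl EL_rec //; ring. Qed.

Lemma lost_beyond_root rho n : 0 < rho ->
  beyond_root n.+1%:R rho (rho - EL rho n).
Proof.
move=> r0; elim: n => [|n IH].
  rewrite EL0 subr0 /beyond_root; split; last lra.
  by have -> : curv 1 rho rho = 0 by rewrite /curv; ring.
rewrite -natr1; apply: beyond_root_step (lost_rec n r0) IH => //.
by rewrite subr_gt0 EL_lt_load.
Qed.

Lemma EL_le_size rho n : 0 < rho -> EL rho n <= n%:R.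
Proof.
move=> r0; elim: n => [|n IH]; first by rewrite EL0.
have En := EL_lt_load n r0; have d0 : 0 < n.+1%:R + (rho - EL rho n).
  by rewrite ltr_wpDl // subr_gt0.
rewrite -(ler_pM2r d0) EL_rec // mulrC ler_pM2l //.
by rewrite -natr1; lra.
Qed.

Lemma EL_lt rho n : 0 < rho -> EL rho n < EL rho n.+1.
Proof.
move=> r0; have E0 := EL_lt_load n r0; have E1 := EL_le_size n r0.
have d0 : 0 < n.+1%:R + (rho - EL rho n) by rewrite ltr_wpDl // subr_gt0.
rewrite -(ltr_pM2r d0) EL_rec // -natr1.
nra.
Qed.

Lemma EL_mono rho m n : 0 < rho -> (m < n)%N -> EL rho m < EL rho n.
Proof.
by move=> r0; apply: (homo_ltn (@lt_trans _ K)) => i; apply: EL_lt.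
Qed.

Lemma EL_gt0 rho n : 0 < rho -> 0 < EL rho n.+1.
Proof. by move=> r0; rewrite -(EL0 rho); apply: EL_mono. Qed.

(** Equivalently, the Erlang loss formula is convex in the number of servers:
    [beyond_root_convex] applied to three consecutive lost rates. *)
Lemma EL_concave rho n : 0 < rho ->
  EL rho n + EL rho n.+2 <= 2 * EL rho n.+1.
Proof.
move=> r0.
have E1 := EL_lt_load n.+1 r0; have E0 := EL_gt0 n r0.
suff : 2 * (rho - EL rho n.+1) <= (rho - EL rho n) + (rho - EL rho n.+2) by lra.
apply: beyond_root_convex (lost_beyond_root n.+1 r0) => //.
- by rewrite subr_gt0 E1 gtrBl.
- by rewrite -[n.+2%:R]natr1 addrK lost_rec.
- by rewrite lost_rec.
Qed.

(** The weight of the marginal cost in [threshold_ratio]; it equals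
    [1 / (E (n + 1) / E n - 1)] for [n > 0]. *)
Definition gap_ratio rho n : K := EL rho n / (EL rho n.+1 - EL rho n).

Lemma gap_ratio0 rho : gap_ratio rho 0 = 0.
Proof. by rewrite /gap_ratio EL0 mul0r. Qed.

Lemma gap_ratio_ge0 rho n : 0 < rho -> 0 <= gap_ratio rho n.
Proof. by move=> r0; rewrite divr_ge0 ?EL_ge0 // subr_ge0 ltW // EL_lt. Qed.

Lemma gap_ratio_le rho n : 0 < rho -> gap_ratio rho n <= gap_ratio rho n.+1.
Proof.
move=> r0; have E0 := EL_lt n r0; have E1 := EL_lt n.+1 r0.
have E2 := EL_concave n r0.
apply: ler_pM; [exact: EL_ge0 | by rewrite invr_ge0 subr_ge0 ltW | exact: ltW |].
by rewrite lef_pV2 ?posrE ?subr_gt0 //; lra.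
Qed.

(** * Dependence of the mean queue length on the load *)

Lemma is_derive_expsum (x : K) n :
  is_derive x 1 (fun r => expsum r n) (expsum x n.-1).
Proof.
elim: n => [|n IH].
  have -> : (fun r : K => expsum r 0) = cst 0.
    by apply/funext => r; rewrite /expsum big_nil.
  by rewrite /expsum big_nil; apply: is_derive_cst.
have -> : (fun r : K => expsum r n.+1) =
    (fun r => expsum r n) + (n`!%:R^-1 : K) \*: ((@id K) ^+ n).
  apply/funext => r; rewrite !fctE expsumS /=.
  by rewrite /GRing.scale /= [_ / _]mulrC.
apply: is_derive_eq.
case: n {IH} => [|n] /=.
  by rewrite mul0r scale0r scaler0 addr0.
rewrite expsumS; congr (_ + _); rewrite factS natrM /GRing.scale /= mulr1.
field.
by rewrite addrC natr1 !pnatr_eq0 -lt0n fact_gt0.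
Qed.

(** For [n = 0] the truncated predecessor does no harm: both sides vanish with
    [EL x 0]. *)
Lemma is_derive_EL x n : 0 < x ->
  is_derive x 1 (fun r => EL r n) (EL x n * (1 + EL x n.-1 - EL x n) / x).
Proof.
move=> x0; have D1 := expsum_gt0 n x0.
have dD := is_derive_expsum x n.
have dV := @is_deriveV K (fun r => expsum r n.+1) _ _ 1 (lt0r_neq0 D1)
  (is_derive_expsum x n.+1).
have -> : (fun r : K => EL r n) =
    (@id K) * (fun r => expsum r n) * (fun r => (expsum r n.+1)^-1).
  by [].
apply: is_derive_eq.
rewrite fctE /= !EL_expsum /GRing.scale /=.
case: n D1 {dD dV} => [|n] D1.
  by rewrite !expsum0 !(mulr0, mul0r, oppr0, addr0).
have D0 := expsum_gt0 n x0; rewrite /=; field.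
by rewrite !gt_eqF.
Qed.

(** Logarithmic differentiation of [E (n + 2) / E (n + 1)] produces the second
    difference of [E] in the number of servers, so concavity in [n] yields
    monotonicity in the load. *)
Lemma EL_ratio_le rho rho' n : 0 < rho -> rho <= rho' ->
  EL rho n.+2 / EL rho n.+1 <= EL rho' n.+2 / EL rho' n.+1.
Proof.
move=> r0 rr.
pose df x := EL x n.+2 / EL x n.+1 * (2 * EL x n.+1 - EL x n.+2 - EL x n) / x.
have D x : 0 < x -> is_derive x 1 (fun r => EL r n.+2 / EL r n.+1) (df x).
  move=> x0; have E1 := EL_gt0 n x0.
  have d2 := is_derive_EL n.+2 x0.
  have dV := @is_deriveV K (fun r => EL r n.+1) _ _ 1 (lt0r_neq0 E1)
    (is_derive_EL n.+1 x0).
  have -> : (fun r => EL r n.+2 / EL r n.+1) =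
      (fun r => EL r n.+2) * (fun r => (EL r n.+1)^-1) by [].
  apply: is_derive_eq; rewrite /df /GRing.scale /=.
  by field; rewrite !gt_eqF.
have pos x : x \in `[rho, rho'] -> 0 < x.
  by rewrite in_itv /= => /andP[xr _]; apply: lt_le_trans xr.
have [x||x /pos x0] := @MVT_segment K (fun r => EL r n.+2 / EL r n.+1) df _ _ rr.
- by move=> /subset_itv_oo_cc /pos; apply: D.
- by apply: derivable_within_continuous => x /pos /D [].
move=> E; rewrite -subr_ge0 E mulr_ge0 ?subr_ge0 // /df.
have conc := EL_concave n x0.
apply: divr_ge0 (ltW x0); apply: mulr_ge0; last lra.
by apply: divr_ge0; apply: EL_ge0.
Qed.

Lemma gap_ratio_anti rho rho' n : 0 < rho -> rho <= rho' ->
  gap_ratio rho' n <= gap_ratio rho n.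
Proof.
case: n => [|n] r0 rr; first by rewrite !gap_ratio0.
have r0' : 0 < rho' by apply: lt_le_trans rr.
have gE (r : K) : 0 < r -> gap_ratio r n.+1 = (EL r n.+2 / EL r n.+1 - 1)^-1.
  move=> r00; rewrite /gap_ratio; have E0 := EL_lt n.+1 r00.
  have E1 := EL_gt0 n r00.
  by field; rewrite gt_eqF //=; apply/eqP; lra.
have g0 (r : K) : 0 < r -> 0 < EL r n.+2 / EL r n.+1 - 1.
  by move=> r00; rewrite subr_gt0 ltr_pdivlMr ?EL_gt0 // mul1r EL_lt.
by rewrite !gE // lef_pV2 ?posrE ?g0 // lerB // EL_ratio_le.
Qed.

End Erlang.

(** * The threshold ratio and the revenue *)

Section Revenue.
Context {K : realType} {R C1 C2 : K}.
Hypotheses (C1_ge0 : 0 <= C1) (C2_ge0 : 0 <= C2) (Cmax_gt0 : 0 < Num.max C1 C2).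
Implicit Types (mu rho P : K) (m n : nat).

Local Notation f rho n := (threshold_ratio rho C1 C2 n).
Local Notation c x := (cost C1 C2 x).

Lemma Csum_gt0 : 0 < C1 + C2.
Proof.
by move: Cmax_gt0; rewrite lt_max => /orP[?|?]; [rewrite ltr_wpDr|rewrite ltr_wpDl].
Qed.

Lemma cost_lt m n : (m < n)%N -> c m%:R < c n%:R.
Proof.
apply: (@homo_ltn _ (fun k => c k%:R) _ lt_trans) => {m n} i.
rewrite -natr1 -subr_gt0 /cost.
have -> : C1 * (i%:R + 1) + C2 * (i%:R + 1) ^+ 2
          - (C1 * i%:R + C2 * i%:R ^+ 2) = (C1 + C2) + C2 * i%:R *+ 2 by ring.
by rewrite ltr_wpDr ?Csum_gt0 // mulrn_wge0 // mulr_ge0.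
Qed.

Lemma cost_le m n : (c m%:R <= c n%:R) = (m <= n)%N.
Proof.
case: leqP => [|/cost_lt lt_c]; last by apply/negbTE; rewrite -ltNge.
by rewrite leq_eqVlt => /orP[/eqP->|/cost_lt/ltW ->]; rewrite ?lexx.
Qed.

Lemma cost_ge_linear n : (C1 + C2) * n%:R <= c n%:R.
Proof.
rewrite mulrDl lerD2l ler_wpM2l // -natrX ler_nat.
by case: n => // n; rewrite leq_pmulr.
Qed.

Lemma threshold_ratio_split rho n : 0 < rho ->
  f rho n.+1 = c n%:R + gap_ratio rho n * (c n%:R - c (n%:R - 1)).
Proof.
move=> r0; have Elt := EL_lt n r0.
rewrite /threshold_ratio /= -natr1 /cost /gap_ratio; field.
by apply/eqP; lra.
Qed.

(** The marginal cost [c 0 - c (- 1) = C1 - C2] may be negative, but its weight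
    [gap_ratio rho 0] vanishes. *)
Lemma gap_increment_ge0 rho n : 0 < rho ->
  0 <= gap_ratio rho n * (c n%:R - c (n%:R - 1)).
Proof.
case: n => [|n] r0; first by rewrite gap_ratio0 mul0r.
rewrite mulr_ge0 ?gap_ratio_ge0 // -natr1 addrK natr1 subr_ge0.
by rewrite cost_le.
Qed.

(** The cost strictly increases, and so does weakly the product of the two
    nonnegative nondecreasing sequences of weights (concavity of the queue
    length) and marginal costs (convexity of the cost). *)
Lemma threshold_ratio_mono rho m n : 0 < rho -> (0 < m < n)%N ->
  f rho m < f rho n.
Proof.
move=> r0; case: m n => // m [] // n; rewrite /= ltnS.
apply: (@homo_ltn _ (fun k => f rho k.+1) _ lt_trans) => {m n} n.
rewrite !threshold_ratio_split //.
rewrite ltr_leD ?cost_lt //.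
case: n => [|n].
  by rewrite gap_ratio0 mul0r gap_increment_ge0.
apply: ler_pM; rewrite ?gap_ratio_ge0 ?gap_ratio_le //.
  by rewrite -natr1 addrK natr1 subr_ge0 cost_le.
rewrite -!natr1 -subr_ge0.
have -> : c (n%:R + 1 + 1) - c (n%:R + 1 + 1 - 1)
    - (c (n%:R + 1) - c (n%:R + 1 - 1)) = C2 *+ 2 by rewrite /cost; ring.
exact: mulrn_wge0.
Qed.

Lemma threshold_ratio_anti rho rho' n : 0 < rho -> rho <= rho' ->
  f rho' n.+1 <= f rho n.+1.
Proof.
move=> r0 rr; have r0' := lt_le_trans r0 rr.
rewrite !threshold_ratio_split // lerD2l.
case: n => [|n]; first by rewrite !gap_ratio0 !mul0r.
rewrite ler_wpM2r ?gap_ratio_anti //.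
by rewrite -natr1 addrK natr1 subr_ge0 cost_le.
Qed.

Lemma revenue_increment mu rho n : 0 < rho ->
  revenue mu rho R C1 C2 n.+1 - revenue mu rho R C1 C2 n =
  mu * (EL rho n.+1 - EL rho n) * (R - f rho n.+1).
Proof.
move=> r0; have Elt := EL_lt n r0.
rewrite /threshold_ratio /= /revenue /cost -natr1; field.
by apply/eqP; lra.
Qed.

(** [f] vanishes at [1] and dominates [(C1 + C2) * (N - 1)], so the admissible
    thresholds form a nonempty bounded set. *)
Lemma ex_last_threshold rho : 0 <= R -> 0 < rho ->
  exists n, is_max (fun N => (1 <= N)%N /\ threshold_ratio rho C1 C2 N <= R) n.
Proof.
move=> R0 r0; pose A N := (0 < N)%N && (f rho N <= R).
have exA : exists N, A N.
  exists 1; rewrite /A threshold_ratio_split // gap_ratio0 mul0r /cost expr0n /=.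
  by rewrite !mulr0 !addr0.
have boundA N : A N -> (N <= (Num.bound (R / (C1 + C2))).+1)%N.
  case: N => [//|N] /andP[_]; apply: contraLR; rewrite -ltnNge ltnS -ltNge => lt_N.
  rewrite threshold_ratio_split // ltr_wpDr ?gap_increment_ge0 //.
  apply: lt_le_trans (cost_ge_linear N).
  rewrite mulrC -ltr_pdivrMr ?Csum_gt0 //.
  apply: lt_trans (archi_boundP _) _; last by rewrite ltr_nat.
  by rewrite divr_ge0 // ltW // Csum_gt0.
case: (ex_maxnP exA boundA) => n /andP[n0 fn] max_n; exists n; split=> // m [m0 fm].
by apply: max_n; rewrite /A m0.
Qed.

(** A price [P] induces threshold [n + 1] exactly when
    [c n <= R - P < c (n + 1)]: the customer who finds [n] others is the last one
    willing to join. *)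
Lemma best_priceE P n : best_price R C1 C2 P n.+1 <-> P = R - c n%:R.
Proof.
have induced Q : induces_threshold R C1 C2 Q n.+1 <->
    c n%:R <= R - Q < c n.+1%:R.
  rewrite /induces_threshold /joins; split=> [H | /andP[lo hi] m].
    have := H n; have := H n.+1; rewrite ltnn ltnSn subr_ge0 => /negbT.
    by rewrite -ltNge subr_ge0 => -> ->.
  rewrite subr_ge0 ltnS; case: leqP => [le_mn | lt_nm].
    by apply: le_trans lo; rewrite cost_le.
  by apply/negbTE; rewrite -ltNge; apply: lt_le_trans hi _; rewrite cost_le.
have top : induces_threshold R C1 C2 (R - c n%:R) n.+1.
  by apply/induced; rewrite opprB addrC subrK lexx cost_lt.
split=> [[/induced /andP[lo _] maxP] | ->]; last first.
  by split=> // Q /induced /andP[lo _]; lra.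
by apply/le_anti; rewrite maxP // andbT; lra.
Qed.

End Revenue.

(** * The optimal threshold *)

Theorem theorem3 (K : realType) (R C1 C2 : K)
    (hR : 0 < R) (hC1 : 0 <= C1) (hC2 : 0 <= C2) (hC : 0 < Num.max C1 C2) :
  exists nm : K -> nat,
    (forall Lambda mu rho : K, 0 < Lambda -> 0 < mu -> rho = Lambda / mu ->
       let S := revenue mu rho R C1 C2 in
       is_max (fun N => (1 <= N)%N /\ threshold_ratio rho C1 C2 N <= R)
              (nm rho)
       /\ (forall n, optimal_threshold mu rho R C1 C2 n <-> n = nm rho)
       /\ (threshold_ratio rho C1 C2 (nm rho) != R ->
           forall m n, (m < n <= nm rho)%N -> S m < S n)
       /\ (forall m n, (m < n < nm rho)%N -> S m < S n)
       /\ (S (nm rho).-1 <= S (nm rho)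
             ?= iff (threshold_ratio rho C1 C2 (nm rho) == R))
       /\ (forall m n, (nm rho <= m < n)%N -> S n < S m)
       /\ (forall P, optimal_price mu rho R C1 C2 P <->
             P = R - (C1 * ((nm rho)%:R - 1) + C2 * ((nm rho)%:R - 1) ^+ 2)))
    /\ (forall rho rho' : K, 0 < rho -> rho <= rho' -> (nm rho <= nm rho')%N).
Proof.
pose f rho := threshold_ratio rho C1 C2.
have ex_nm rho : exists n, 0 < rho ->
    is_max (fun N => (1 <= N)%N /\ f rho N <= R) n.
  have [r0|_] := boolP (0 < rho); last by exists 0%N.
  by have [n nP] := ex_last_threshold hC1 hC2 hC (ltW hR) r0; exists n.
have [nm nmP] := choice ex_nm.
exists nm; split=> [Lambda mu rho L0 mu0 rhoE S | rho rho' r0 rr]; last first.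
  have [[n0 fn] _] := nmP _ r0; have [_ max_nm] := nmP _ (lt_le_trans r0 rr).
  apply: max_nm; split=> //; apply: le_trans fn.
  by case: (nm rho) n0 => // n _; apply: threshold_ratio_anti.
have r0 : 0 < rho by rewrite rhoE divr_gt0.
have nmax := nmP _ r0; have [[nm0 fnm] max_nm] := nmax.
have fmono := threshold_ratio_mono hC1 hC2 hC r0.
have stepE n : (S n < S n.+1) = (f rho n.+1 < R)
    /\ (S n.+1 < S n) = (R < f rho n.+1).
  have dE0 : 0 < mu * (EL rho n.+1 - EL rho n).
    by rewrite mulr_gt0 // subr_gt0 EL_lt.
  split; rewrite -[LHS]subr_gt0 ; last rewrite -oppr_lt0 opprB.
    by rewrite revenue_increment // pmulr_rgt0 // subr_gt0.
  by rewrite revenue_increment // pmulr_rlt0 // subr_lt0.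
have above n : (nm rho < n)%N -> R < f rho n.
  move=> lt_n; rewrite ltNge; apply/negP => fn.
  suff : (n <= nm rho)%N by rewrite leqNgt lt_n.
  by apply: max_nm; split=> //; apply: leq_trans lt_n.
have up k : (forall n, (0 < n <= k)%N -> f rho n < R) ->
    forall m n, (m < n <= k)%N -> S m < S n.
  move=> below m; elim=> [//|n IH] /andP[lt_mn le_nk].
  have Sn : S n < S n.+1 by rewrite (stepE n).1 below.
  move: lt_mn; rewrite ltnS leq_eqVlt => /orP[/eqP->//|lt_mn].
  by apply: lt_trans Sn; apply: IH; rewrite lt_mn ltnW.
have down m n : (nm rho <= m < n)%N -> S n < S m.
  elim: n => [|n IH] /andP[le_m]; rewrite ?ltn0 // ltnS => le_mn.
  have Sn : S n.+1 < S n.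
    by rewrite (stepE n).2 above // ltnS (leq_trans le_m).
  move: le_mn; rewrite leq_eqVlt => /orP[/eqP->//|lt_mn].
  by apply: lt_trans Sn _; apply: IH; rewrite le_m.
have top : S (nm rho).-1 <= S (nm rho) ?= iff (f rho (nm rho) == R).
  have inc := revenue_increment (R := R) (C1 := C1) (C2 := C2) mu (nm rho).-1 r0.
  have d0 : 0 < mu * (EL rho (nm rho) - EL rho (nm rho).-1).
    by rewrite mulr_gt0 // subr_gt0 EL_mono // prednK.
  move: inc; rewrite prednK // => inc; split.
    by rewrite -subr_ge0 inc mulr_ge0 ?subr_ge0 // ltW.
  by rewrite eq_sym -subr_eq0 inc mulf_eq0 gt_eqF //= subr_eq0 eq_sym.
have opt n : optimal_threshold mu rho R C1 C2 n <-> n = nm rho.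
  split=> [[n0 le_pred gt_succ] | ->]; last first.
    by split; [|exact: top.1 | apply: down; rewrite leqnn ltnSn].
  case: (ltngtP n (nm rho)) => // [lt_n | gt_n].
    move: gt_succ; rewrite (stepE n).2 ltNge => /negP[].
    apply: le_trans fnm; move: lt_n; rewrite leq_eqVlt => /orP[/eqP->//|lt_n].
    by apply: ltW; apply: fmono.
  case: n n0 le_pred gt_n {gt_succ} => // n _ /= le_pred /above.
  by rewrite -(stepE n).2 ltNge le_pred.
split=> //; split=> //; split.
  move=> fneq; apply: up => n /andP[n0]; rewrite leq_eqVlt => /orP[/eqP->|lt_n].
    by rewrite lt_neqAle fneq.
  by apply: lt_le_trans fnm; apply: fmono; rewrite n0.
split.
  move=> m n /andP[lt_mn lt_n]; apply: (up (nm rho).-1).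
    move=> i /andP[i0 le_i]; apply: lt_le_trans fnm; apply: fmono.
    by rewrite i0 -(prednK nm0) ltnS.
  by rewrite lt_mn -ltnS prednK.
split=> //; split=> // P.
have priceE : best_price R C1 C2 P (nm rho) <->
    P = R - (C1 * ((nm rho)%:R - 1) + C2 * ((nm rho)%:R - 1) ^+ 2).
  by rewrite -(prednK nm0) best_priceE // -natr1 addrK.
split=> [[n [/opt ->]] /priceE // | /priceE bestP].
by exists (nm rho); split=> //; apply/opt.
Qed.
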